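(* Let $d\in\mathbb{N}$ and let $\Omega\subset\mathbb{R}^d$ be a connected, bounded $C^1$ domain. Let $M,\delta,a,b,r_0>0$ and $\sigma$ be constants such that $1\leq\sigma<1+1/b$. Then for any measurable set $E\subset\Omega$ with positive measure there is a constant $C>0$, depending only on $M,\delta,a,b,r_0,\sigma,|\Omega|/|E|$, and $\Omega$, such that the following holds. If $f\in C^\infty(\Omega)$ satisfies $$\Vert \partial^\alpha f\Vert_{L^\infty(\Omega)}\leq \frac{M\,(|\alpha|!)^{\sigma}}{\delta^{|\alpha|}}\Vert f\Vert_{L^\infty(\Omega)}\qquad\text{for all }\alpha\in\mathbb{N}_0^d$$ and $$\Vert f\Vert_{L^\infty(\Omega)}\leq \exp\left(\frac{a}{r^b}\right)\Vert f\Vert_{L^\infty(B_r(x)\cap\Omega)}\qquad\text{for all }r\in(0,r_0]\text{ and all }x\in\Omega,$$ then $$\Vert f\Vert_{L^\infty(\Omega)}\leq C\,\Vert f\Vert_{L^\infty(E)}.$$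
   Context: $|\cdot|$ denotes Lebesgue measure of sets, and $|\alpha|=\alpha_1+\cdots+\alpha_d$ for a multi-index $\alpha\in\mathbb{N}_0^d$. $B_r(x)$ is the open Euclidean ball of radius $r$ centered at $x$. *)

(* Defs.v *)
From HB Require Import structures.
From mathcomp Require Import all_boot all_order all_algebra.
From mathcomp Require Import all_classical all_reals all_analysis.

Set Implicit Arguments.
Unset Strict Implicit.
Unset Printing Implicit Defensive.

Import Order.TTheory GRing.Theory Num.Theory.
Import numFieldNormedType.Exports.

Local Open Scope classical_set_scope.
Local Open Scope ring_scope.

(* R^n is 'rV[R]_n.  The library topology on it comes from the sup norm; it is
   the Euclidean one, but its balls are cubes, hence [enorm] and [eball]. *)

Section euclidean.
Context {R : realType} {n : nat}.
Implicit Types x y : 'rV[R]_n.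

Definition enorm x : R := Num.sqrt (\sum_(i < n) x 0 i ^+ 2).

Definition eball x (r : R) : set 'rV[R]_n := [set y | enorm (y - x) < r].

End euclidean.

(* Lebesgue measure on R^n: the n-fold product of the one-dimensional Lebesgue
   measure, on the sigma-algebra generated by the coordinates, then completed
   (Caratheodory-measurable sets of the induced outer measure). *)

Definition cylinders (R : realType) (n : nat) : set (set 'rV[R]_n) :=
  [set C | exists i : 'I_n, exists2 A : set (measurableTypeR R),
     measurable A & C = [set x : 'rV[R]_n | A (x 0 i)]].

Definition borel_rV (R : realType) (n : nat) :=
  g_sigma_algebraType (@cylinders R n).

Section product_lebesgue_step.
Context {R : realType} {n : nat}.

Definition cons_rV (p : measurableTypeR R * borel_rV R n) : borel_rV R n.+1 :=
  row_mx (p.1 : R)%:M (p.2 : 'rV[R]_n).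

Definition uncons_rV (x : borel_rV R n.+1) : measurableTypeR R * borel_rV R n :=
  ((x : 'rV[R]_n.+1) 0 0, rsubmx (x : 'rV[R]_(1 + n))).

Lemma uncons_rVK : cancel cons_rV uncons_rV.
Proof.
move=> [t v]; rewrite /uncons_rV /cons_rV /= row_mxKr; congr pair.
transitivity (row_mx (t : R)%:M (v : 'rV[R]_n) 0 (lshift n 0)).
  by congr (row_mx _ _ _ _); exact: val_inj.
by rewrite row_mxEl mxE.
Qed.

Lemma measurable_coord m (i : 'I_m) :
  measurable_fun [set: borel_rV R m]
    (fun x => (x : 'rV[R]_m) 0 i : measurableTypeR R).
Proof.
move=> _ A mA; rewrite setTI; apply: sub_sigma_algebra.
by exists i; exists A.
Qed.

Lemma measurable_rVP d (T : measurableType d) m (g : T -> borel_rV R m) :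
  (forall i, measurable_fun [set: T]
     (fun t => (g t : 'rV[R]_m) 0 i : measurableTypeR R)) ->
  measurable_fun [set: T] g.
Proof.
move=> mg; have E : @measurable _ (borel_rV R m) = <<s @cylinders R m >> by [].
apply: (measurability _ E) => _ [_ [i [A mA ->]] <-].
exact: mg.
Qed.

Lemma measurable_cons_rV : measurable_fun setT cons_rV.
Proof.
apply: measurable_rVP => i; rewrite /cons_rV.
case: (split_ordP (i : 'I_(1 + n))) => j ->.
  rewrite (_ : (fun _ => _) = fst) //.
  by apply/funext => p; apply: etrans (row_mxEl _ _ _ _) _; rewrite mxE ord1.
rewrite (_ : (fun _ => _) =
    (fun x : borel_rV R n => (x : 'rV[R]_n) 0 j : measurableTypeR R) \o snd).
  by apply: measurableT_comp => //; exact: measurable_coord.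
by apply/funext => p; exact: row_mxEr.
Qed.

Lemma measurable_uncons_rV : measurable_fun setT uncons_rV.
Proof.
apply/measurable_fun_pairP; split; first exact: measurable_coord.
apply: measurable_rVP => i.
rewrite (_ : (fun _ => _) = (fun x : borel_rV R n.+1 =>
    (x : 'rV[R]_n.+1) 0 (rshift 1 i) : measurableTypeR R)).
  exact: measurable_coord.
by apply/funext => x /=; rewrite !mxE.
Qed.

(* The library declares conflicting sigma-finite instances for \x, so sigma-
   finiteness is established directly below. *)
Variable mu : {sigma_finite_measure set (borel_rV R n) -> \bar R}.

Definition lebesgue_prod : set (borel_rV R n.+1) -> \bar R :=
  pushforward (@lebesgue_measure R \x mu)%E cons_rV.

Let lebesgue_prod0 : lebesgue_prod set0 = 0%E.
Proof. by rewrite /lebesgue_prod /pushforward preimage_set0 measure0. Qed.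

Let lebesgue_prod_ge0 A : (0 <= lebesgue_prod A)%E.
Proof. exact: (measure_ge0 (@lebesgue_measure R \x mu)%E). Qed.

Let lebesgue_prod_sigma_additive : semi_sigma_additive lebesgue_prod.
Proof.
have mpre A : measurable A -> measurable (cons_rV @^-1` A).
  by move=> mA; rewrite -[X in measurable X]setTI; exact: measurable_cons_rV.
move=> F mF tF mUF; rewrite /lebesgue_prod /pushforward preimage_bigcup.
apply: (measure_semi_sigma_additive (s := (@lebesgue_measure R \x mu)%E)).
- by move=> i; exact: mpre.
- apply/trivIsetP => i j _ _ ij; rewrite -preimage_setI.
  by move/trivIsetP : tF => /(_ _ _ _ _ ij) ->//; rewrite preimage_set0.
- by rewrite -preimage_bigcup; exact: mpre.
Qed.

HB.instance Definition _ := isMeasure.Build _ _ _ lebesgue_prod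
  lebesgue_prod0 lebesgue_prod_ge0 lebesgue_prod_sigma_additive.

Let lebesgue_prod_sigma_finite : sigma_finite setT lebesgue_prod.
Proof.
have /sigma_finiteP[F [FT ndF Foo]] := sigma_finiteT (@lebesgue_measure R).
have /sigma_finiteP[G [GT ndG Goo]] := sigma_finiteT mu.
exists (fun k => uncons_rV @^-1` (F k `*` G k)).
  rewrite -preimage_bigcup -[LHS](preimage_setT uncons_rV); congr (_ @^-1` _).
  rewrite -setXTT FT GT predeqE => -[x y]; split.
    move=> [/= [i _ Fix] [j _ Gjy]]; exists (maxn i j) => //; split.
    - by move: x Fix; exact/subsetPset/ndF/leq_maxl.
    - by move: y Gjy; exact/subsetPset/ndG/leq_maxr.
  by move=> [i _ [/= Fix Giy]]; split; exists i.
move=> k; have [mF Fk] := Foo k; have [mG Gk] := Goo k; split.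
  rewrite -[X in measurable X]setTI.
  by apply: measurable_uncons_rV => //; exact: measurableX.
rewrite /lebesgue_prod /pushforward -comp_preimage.
rewrite (_ : uncons_rV \o cons_rV = id).
  by rewrite preimage_id product_measure1E// lte_mul_pinfty// ge0_fin_numE.
by apply/funext => p; exact: uncons_rVK.
Qed.

HB.instance Definition _ := @Measure_isSigmaFinite.Build _ _ _
  lebesgue_prod lebesgue_prod_sigma_finite.

End product_lebesgue_step.

Fixpoint borel_lebesgue (R : realType) (n : nat) :
    {sigma_finite_measure set (borel_rV R n) -> \bar R} :=
  match n return {sigma_finite_measure set (borel_rV R n) -> \bar R} with
  | 0 => \d_((0 : 'rV[R]_0) : borel_rV R 0)
  | m.+1 => lebesgue_prod (borel_lebesgue R m)
  end.

Definition lebesgue_type (R : realType) (n : nat) :=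
  caratheodory_type (borel_lebesgue R n)^*%mu.

HB.instance Definition _ (R : realType) (n : nat) :=
  Measurable.on (lebesgue_type R n).

Definition lebesgue_rV (R : realType) (n : nat) :
    set (lebesgue_type R n) -> \bar R :=
  @completed_measure_extension _ _ _ (borel_lebesgue R n).

HB.instance Definition _ (R : realType) (n : nat) :=
  Measure.on (@lebesgue_rV R n).

Definition lebesgue_measurable (R : realType) (n : nat) (E : set 'rV[R]_n) :=
  measurable (E : set (lebesgue_type R n)).

(* [f \_ D] is f extended by 0 outside D, so this is the essential supremum of
   |f| over D (possibly +oo). *)
Definition Linfty_norm (R : realType) (n : nat) (D : set 'rV[R]_n)
    (f : 'rV[R]_n -> R) : \bar R :=
  Lnorm (@lebesgue_rV R n) +oo%E (EFin \o f \_ D).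

Section smooth_functions.
Context {R : realType} {n : nat}.
Implicit Types (f : 'rV[R]_n -> R) (D : set 'rV[R]_n) (s : seq 'I_n).

Definition pderiv (i : 'I_n) f : 'rV[R]_n -> R := 'D_(delta_mx 0 i) f.

Definition pderivs s f := foldr pderiv f s.

(* d_0^(alpha 0) ... d_(n-1)^(alpha (n-1)) f *)
Definition mderiv (alpha : 'I_n -> nat) f :=
  foldr (fun i => iter (alpha i) (pderiv i)) f (enum 'I_n).

Definition mlength (alpha : 'I_n -> nat) : nat := (\sum_(i < n) alpha i)%N.

(* The values of f off the open set D are irrelevant: derivatives at a point of
   D depend only on f near that point. *)
Definition C_on (k : nat) D f := forall s, (size s <= k)%N -> forall x, D x ->
  {for x, continuous (pderivs s f)} /\
  ((size s < k)%N -> forall i, derivable (pderivs s f) x (delta_mx 0 i)).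

Definition Cinfty_on D f := forall k, C_on k D f.

End smooth_functions.

(* Near each boundary point, in suitable orthonormal coordinates x *m Q, the set
   is the part of a ball lying strictly above the graph of a C^1 function of
   the first n coordinates. *)
Definition C1_boundary (R : realType) (n : nat) (Omega : set 'rV[R]_n.+1) :=
  forall p, (closure Omega `\` Omega°) p ->
  exists (r : R) (Q : 'M[R]_n.+1) (gamma : 'rV[R]_n -> R),
    [/\ 0 < r, Q *m Q^T = 1%:M, C_on 1 setT gamma &
      Omega `&` eball p r = [set x | eball p r x /\
        gamma (col' ord_max (x *m Q)) < (x *m Q) 0 ord_max]].

(* Main.v *)
Require Import Defs.
From mathcomp Require Import all_boot all_order all_algebra.
From mathcomp Require Import all_classical all_reals all_analysis.
From mathcomp Require Import measurable_realfun lebesgue_integral ess_sup_inf.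
From mathcomp Require Import ring lra zify.

Import Order.TTheory GRing.Theory Num.Theory.
Import numFieldNormedType.Exports.

Local Open Scope classical_set_scope.
Local Open Scope ring_scope.

(** Write e and F for the sup norms of f on E and on Omega.  At a small scale h,
    E fills a fixed proportion theta of some cube Q of side h inside Omega, and
    smallness of f on E /\ Q spreads to all of Q at a cost K^N per coordinate,
    up to the error made by polynomials of degree < N.  The lower bound for f on
    the ball inscribed in Q then prevents e from being small compared with F.

    _The cube_ ([half_level_cell]).  The dyadic cells of side h = 2^-m contained
    in Omega exhaust Omega as m grows, so for m large, depending only on Omega
    and rho = |Omega| / |E|, they miss less than half of |E|.  By the pigeonhole
    principle one of them is filled by E in a proportion at least 1 / (2 rho).
    That this proportion does not deteriorate as h decreases is what lets h be
    chosen afterwards.  Continuity of f makes {|f| <= e} a Borel set containing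
    almost all of E, and the argument is carried out for that set.

    _One variable_ ([line_propagation]).  A set A of measure kappa h in an
    interval of length h contains N points with consecutive gaps kappa h / (2N).
    The Lagrange basis at these points sums to at most (4 e / kappa)^N on the
    interval ([lagrange_basis_bound]; the factorials coming from the products of
    node distances are essential here), and the interpolation error is
    g^(N) h^N / N! ([interpolation_error], by iterating Rolle's theorem).

    _Several variables_ ([box_propagation]).  By Fubini a set of measure
    (n+2) kappa h^(n+1) in a cube has slices of measure (n+1) kappa h^n over a
    set of measure kappa h of values of the first coordinate ([large_slices]).
    By induction f is small on those slices, and then on every line parallel to
    the first axis.  The derivatives entering are the pure ones of order N.

    _Choice of N_ ([gevrey_beats_vanishing]).  With s = sigma - 1 the accumulated
    error is at most a constant times (q h N^s)^N F.  For N about T h^-b the base is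
    q T^s h^(1 - b s), which tends to 0 because b s < 1, so the error is at most
    a constant times exp(-N) F, and below half of the lower bound
    exp(-a / (h/2)^b) F once T is large enough.  Absorbing it gives the estimate
    for h fixed. *)

(** * Interpolation in one variable *)

Section interpolation.
Context {R : realType}.
Implicit Types (a b x : R) (s : seq R) (G : nat -> R -> R).

Definition in_co a b : pred R := fun t => a <= t < b.

(** Rolle's theorem between consecutive zeros.  Zeros are listed as paths for <
    so that the new ones again come out distinct and ordered, which is what the
    iteration in [Rolle_iter] consumes. *)
Lemma Rolle_interlace (g g' : R -> R) a b x s :
    (forall t, in_co a b t -> is_derive t 1 g (g' t)) ->
    path <%R x s -> all (in_co a b) (x :: s) -> all (fun t => g t == 0) (x :: s) ->
  exists s', [/\ size s' = size s, path <%R x s', all (in_co a b) s' &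
                 all (fun t => g' t == 0) s'].
Proof.
move=> dg; elim: s x => [|y s IH] x /=; first by exists [::].
move=> /andP[xy pys] /and3P[xab yab sab] /and3P[/eqP gx0 /eqP gy0 gs0].
have [||s' [ss' pys' s'ab s'0]] := IH y pys; rewrite /= ?yab ?gy0 ?eqxx//.
have sub t : x <= t <= y -> in_co a b t.
  move: xab yab; rewrite /in_co => /andP[ax xb] /andP[ay yb] /andP[xt ty].
  by rewrite (le_trans ax xt) (le_lt_trans ty yb).
have [t|||z] := @Rolle R g x y xy.
- rewrite in_itv/= => /andP[xt ty].
  have /dg[] // : in_co a b t by apply: sub; rewrite !ltW.
- apply: derivable_within_continuous => t; rewrite in_itv/= => /sub/dg[] //.
- by rewrite gx0 gy0.
rewrite in_itv/= => /andP[xz zy] dz.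
have zab : in_co a b z by apply: sub; rewrite !ltW.
have z0 : g' z = 0 by have [_ <-] := dg z zab; case: dz.
exists (z :: s'); rewrite /= ss' xz zab z0 eqxx s'ab s'0; split => //=.
by case: s' {ss' s'ab s'0} pys' => //= w s' /andP[yw ->]; rewrite (lt_trans zy yw).
Qed.

Lemma Rolle_iter G N a b s :
    (forall k t, (k < N)%N -> in_co a b t -> is_derive t 1 (G k) (G k.+1 t)) ->
    size s = N.+1 -> sorted <%R s -> all (in_co a b) s ->
    all (fun t => G 0%N t == 0) s ->
  exists2 t, in_co a b t & G N t = 0.
Proof.
elim: N G s => [|N IH] G [|x s]//= dG [ss] pxs sab s0.
  by move: sab s0 => /andP[xab _] /andP[/eqP ? _]; exists x.
have [s' [ss' pxs' s'ab s'0]] :=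
  @Rolle_interlace (G 0%N) (G 1%N) _ _ _ _ (fun t => dG 0%N t isT) pxs sab s0.
apply: (IH (fun k => G k.+1) s') => //.
- by move=> k t kN; exact: dG.
- by rewrite ss'.
- exact: path_sorted pxs'.
Qed.

Lemma derivn_size_le (q : {poly R}) N :
  (size q <= N.+1)%N -> q^`(N) = (q`_N *+ N`!)%:P.
Proof.
move=> sq; apply/polyP => i; rewrite coef_derivn coefC.
case: i => [|i]; first by rewrite addn0 ffactnn.
by rewrite /= nth_default ?mul0rn// (leq_trans sq)// addnS ltnS leq_addr.
Qed.

Lemma is_derive_derivn (q : {poly R}) k (t : R) :
  is_derive t 1 (horner q^`(k)) q^`(k.+1).[t].
Proof. by rewrite derivnS; exact: is_derive_poly. Qed.

(** Let w be the product of the 'X - u and choose c so that G 0 - q - c w also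
    vanishes at x.  It then has N + 1 zeros, so its N-th derivative G N - c N!
    vanishes somewhere: the lower coefficients of q + c w disappear, and w is
    monic of degree N. *)
Lemma interpolation_error G N a b (s : seq R) (q : {poly R}) x :
    (forall k t, (k < N)%N -> in_co a b t -> is_derive t 1 (G k) (G k.+1 t)) ->
    size s = N -> uniq s -> all (in_co a b) s -> (size q <= N)%N ->
    all (fun t => q.[t] == G 0%N t) s -> in_co a b x ->
  exists2 t, in_co a b t &
    G 0%N x - q.[x] = G N t / N`!%:R * \prod_(u <- s) (x - u).
Proof.
move=> dG ss us sab sq qs xab.
pose w := \prod_(u <- s) ('X - u%:P).
have wE y : w.[y] = \prod_(u <- s) (y - u).
  by rewrite /w horner_prod; apply: eq_bigr => u _; rewrite hornerXsubC.
rewrite -wE; have [xs|xs] := boolP (x \in s).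
  exists x => //; rewrite (eqP (allP qs x xs)) subrr wE.
  by rewrite (big_rem x)//= subrr mul0r mulr0.
have w0 : w.[x] != 0.
  rewrite wE prodf_seq_neq0; apply/allP => u us' /=.
  by rewrite subr_eq0; apply: contraNneq xs => ->.
pose c := (G 0%N x - q.[x]) / w.[x].
pose p := q + c *: w.
have sw : size w = N.+1 by rewrite size_prod_XsubC ss.
have wN : w`_N = 1.
  by have /monicP := monic_prod_XsubC s xpredT id; rewrite lead_coefE -/w sw.
have sp : (size p <= N.+1)%N.
  rewrite (leq_trans (size_polyD _ _))// geq_max (leq_trans sq)//=.
  by rewrite (leq_trans (size_scale_leq _ _))// sw.
have pN : p`_N = c by rewrite coefD coefZ wN mulr1 nth_default ?add0r.
have [|||||t tab] := @Rolle_iter (fun k t => G k t - p^`(k).[t]) N a b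
    (sort <=%R (x :: s)).
- move=> k t kN tab; have ? := dG k t kN tab; have ? := is_derive_derivn p k t.
  exact: is_deriveB.
- by rewrite size_sort/= ss.
- by rewrite sort_lt_sorted/= xs us.
- by rewrite all_sort/= xab sab.
- rewrite all_sort; apply/allP => u; rewrite in_cons derivn0 hornerD hornerZ.
  case/predU1P => [->|us']; first by rewrite /c mulfVK// subrKC subrr.
  by rewrite wE (big_rem u)//= subrr mul0r mulr0 addr0 (eqP (allP qs u us')) subrr.
rewrite derivn_size_le// pN hornerC => /eqP; rewrite subr_eq0 => /eqP GN.
exists t => //; rewrite GN -[c *+ _]mulr_natr mulfK ?pnatr_eq0 -?lt0n ?fact_gt0//.
by rewrite /c mulfVK.
Qed.

End interpolation.

Section lagrange.
Context {R : realType}.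
Implicit Types (t : nat -> R) (g h x : R).

Definition lagrange_basis t m (j : 'I_m.+1) : {poly R} :=
  \prod_(k < m.+1 | k != j) ((t j - t k)^-1 *: ('X - (t k)%:P)).

Lemma lagrange_basisE t m j x :
  (lagrange_basis t m j).[x] = \prod_(k < m.+1 | k != j) ((x - t k) / (t j - t k)).
Proof.
rewrite /lagrange_basis horner_prod; apply: eq_bigr => k _.
by rewrite hornerZ hornerXsubC mulrC.
Qed.

Lemma size_lagrange_basis t m j : (size (lagrange_basis t m j) <= m.+1)%N.
Proof.
rewrite /lagrange_basis scaler_prod (leq_trans (size_scale_leq _ _))//.
rewrite size_prod => [|k _]; last by rewrite polyXsubC_eq0.
under eq_bigr do rewrite size_XsubC.
by rewrite sum_nat_const cardC1 card_ord; lia.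
Qed.

Lemma separated_dist t m g i j :
    (forall i, (i < m)%N -> t i + g <= t i.+1) -> (i <= j <= m)%N ->
  g * (j - i)%:R <= t j - t i.
Proof.
move=> tg /andP[]; elim: j => [|j IH].
  by rewrite leqn0 => /eqP-> _; rewrite !subrr mulr0.
rewrite leq_eqVlt => /predU1P[->|ij jm]; first by rewrite subnn subrr mulr0.
rewrite subSn// -natr1; have := IH ij (ltnW jm); have := tg j jm; lra.
Qed.

(** With truncated subtraction, (k - j) + (j - k) is |k - j|. *)
Lemma prod_dist m (j : 'I_m.+1) :
  (\prod_(k < m.+1 | k != j) ((k - j) + (j - k)) = j`! * (m - j)`!)%N.
Proof.
have jm := ltn_ord j; rewrite -(big_mkord (fun k => k != j) (fun k => ((k - j) + (j - k))%N)).
rewrite (@big_cat_nat _ _ _ j)//= 1?ltnW// big_nat_cond [X in (_ * X)%N]big_ltn_cond//.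
rewrite eqxx /=; congr muln.
  rewrite fact_prod big_add1 big_nat_rev/= [LHS]big_nat_cond [RHS]big_nat_cond.
  by apply: eq_big => k; rewrite add0n; lia.
rewrite fact_prod -[X in bigop.body _ (index_iota X _)]add1n big_addn -subSn// big_nat_cond.
rewrite [RHS]big_nat_cond; apply: eq_big => k; lia.
Qed.

(** Nodes number j and k are at distance at least g |k - j|, and the product of
    the |k - j| over k is j! (m - j)!.  Summing the reciprocals over j produces
    the binomial coefficients divided by m!, hence 2^m / m!.  With the cruder
    distance g for all pairs the factor 1 / m! would be lost, and the resulting
    growth m^m could not be absorbed by the Gevrey bound. *)
Lemma lagrange_basis_bound t m g h x :
    0 < g -> (forall i, (i < m)%N -> t i + g <= t i.+1) ->
    (forall i, (i <= m)%N -> `|x - t i| <= h) ->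
  \sum_(j < m.+1) `|(lagrange_basis t m j).[x]| <= (2 * (h / g)) ^+ m / m`!%:R.
Proof.
move=> g0 tg xt.
have h0 : 0 <= h by rewrite (le_trans _ (xt 0%N _)).
have dist i j : (i <= m)%N -> (j <= m)%N -> g * ((i - j) + (j - i))%:R <= `|t j - t i|.
  move=> im jm; have [ij|/ltnW ji] := leqP i j.
    rewrite (eqP ij) add0n (le_trans _ (ler_norm _))//.
    by apply: (separated_dist _ m) => //; rewrite ij.
  rewrite (eqP ji) addn0 distrC (le_trans _ (ler_norm _))//.
  by apply: (separated_dist _ m) => //; rewrite ji.
have f0 k : (0 : R) < k`!%:R by rewrite ltr0n fact_gt0.
have -> : (2 * (h / g)) ^+ m / m`!%:R =
    \sum_(j < m.+1) (h / g) ^+ m / (j`! * (m - j)`!)%:R.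
  rewrite exprMn mulrC [2 ^+ m * _]mulrC mulrA [_ * (h / g) ^+ m]mulrC.
  rewrite -mulrA -mulr_sumr; congr (_ * _).
  rewrite (_ : 2 = 1 + 1)// exprDn mulr_sumr; apply: eq_bigr => j _.
  rewrite !expr1n mulr1 -(bin_fact (ltn_ord j : (j <= m)%N)).
  rewrite natrM -mulr_natr mul1r invfM mulrAC mulVf ?mul1r//.
  by rewrite pnatr_eq0 -lt0n bin_gt0 -ltnS.
apply: ler_sum => j _; rewrite lagrange_basisE normr_prod.
have -> : (h / g) ^+ m / (j`! * (m - j)`!)%:R =
    \prod_(k < m.+1 | k != j) (h / (g * ((k - j) + (j - k))%:R)).
  have -> : (h / g) ^+ m = \prod_(k < m.+1 | k != j) (h / g).
    by rewrite prodr_const cardC1 card_ord.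
  rewrite -prod_dist natr_prod -prodfV -big_split/=; apply: eq_bigr => k _.
  by rewrite invfM mulrA.
apply: ler_prod => k kj; rewrite normr_ge0/= normrM normfV.
have kj0 : 0 < g * ((k - j) + (j - k))%:R.
  rewrite mulr_gt0// ltr0n; move: kj; rewrite -(inj_eq val_inj)/=; lia.
apply: ler_pM; rewrite ?invr_ge0//; first by apply: xt; rewrite -ltnS.
by rewrite lef_pV2 ?posrE ?dist ?(lt_le_trans kj0) ?dist// -ltnS.
Qed.

Lemma lagrange_basis_sample t m (i j : 'I_m.+1) :
  (forall k l : 'I_m.+1, t k = t l -> k = l) ->
  (lagrange_basis t m j).[t i] = (i == j)%:R.
Proof.
move=> ti; rewrite lagrange_basisE; have [->|ij] := eqVneq.
  rewrite big1// => k kj; rewrite divff// subr_eq0; apply: contra_neq kj.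
  by move/ti.
by rewrite (bigD1 i)//= subrr mul0r mul0r.
Qed.

(** The quotient of consecutive terms is (1 + 1 / (m + 1)) ^ (m + 1) <= e. *)
Lemma natSXn_le m : (m.+1)%:R ^+ m / m`!%:R <= expR 1 ^+ m :> R.
Proof.
elim: m => [|m IH]; first by rewrite !expr0 divr1.
have m0 k : (0 : R) < k.+1%:R by rewrite ltr0n.
have -> : m.+2%:R ^+ m.+1 / (m.+1)`!%:R =
    (m.+2%:R / m.+1%:R) ^+ m.+1 * (m.+1%:R ^+ m / m`!%:R) :> R.
  rewrite factS natrM expr_div_n [in X in _ = _ / X * _]exprS.
  have := m0 m; have : (0 : R) < m`!%:R by rewrite ltr0n fact_gt0.
  have : (0 : R) < m.+1%:R ^+ m by rewrite exprn_gt0.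
  move=> *; field; lra.
rewrite [leRHS]exprS ler_pM// ?exprn_ge0 ?divr_ge0 ?exprn_ge0//.
have -> : expR 1 = expR (m.+1%:R^-1) ^+ m.+1 :> R.
  by rewrite -expRM_natl mulfV// gt_eqF.
rewrite ler_pXn2r ?nnegrE ?expR_ge0 ?divr_ge0//.
rewrite (le_trans _ (expR_ge1Dx _))// -[m.+2]addn1 natrD mulrDl divff ?gt_eqF//.
by rewrite mul1r.
Qed.

End lagrange.

Section propagation.
Context {R : realType}.
Local Notation lambda := (@lebesgue_measure R).

(** Greedy choice: take a point of A within g of its infimum, discard everything
    up to distance g to the right of it, and start again.  The discarded part
    lies in an interval of length 2 g, so each round costs measure 2 g. *)
Lemma separated_points (A : set R) a g m :
    measurable A -> A `<=` `[a, +oo[ -> 0 < g ->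
    (((m.*2)%:R * g)%:E < lambda A)%E ->
  exists t : nat -> R, (forall i, (i <= m)%N -> A (t i)) /\
    (forall i, (i < m)%N -> t i + g <= t i.+1).
Proof.
move=> mA Aa g0; elim: m A a mA Aa => [|m IH] A a mA Aa lA.
  have [A0|/set0P[x Ax]] := eqVneq A set0.
    by move: lA; rewrite A0 mul0r measure0 ltxx.
  by exists (fun=> x); split.
have [A0|/set0P A0] := eqVneq A set0.
  by move: lA; rewrite A0 measure0 lte_fin ltNge mulr_ge0// ltW.
have hA : has_inf A.
  by split => //; exists a => x /Aa; rewrite /= in_itv/= andbT.
have [t At ti] := inf_adherent g0 hA.
pose A' := A `&` `]t + g, +oo[.
have mA' : measurable A' by exact: measurableI.
have : (lambda A <= lambda A' + (2 * g)%:E)%E.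
  apply: (@le_trans _ _ (lambda (A' `|` `[inf A, inf A + 2 * g]))).
    apply: le_measure; rewrite ?inE//; first exact: measurableU.
    move=> x Ax; have [xt|tx] := leP x (t + g); last first.
      by left; split => //=; rewrite in_itv/= tx.
    right; rewrite /= in_itv/= (ge_inf hA.2)//=; lra.
  have mI : lambda `[inf A, inf A + 2 * g] = (2 * g)%:E.
    rewrite lebesgue_measure_itv/= lte_fin ifT; last by lra.
    by rewrite -EFinD; congr EFin; ring.
  by rewrite -mI; apply: measureU2.
move=> lA'; have [||s [sA sg]] := IH A' (t + g) mA'.
- by move=> x [_]; rewrite /= !in_itv/= !andbT => /ltW.
- have := lt_le_trans lA lA'; rewrite -lteBlDr// -EFinB; apply: le_lt_trans.
  by rewrite lee_fin doubleS -!natr1; lra.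
exists (fun i => if i is j.+1 then s j else t); split => [[|i]// /sA[]//|].
move=> [|i]; last exact: sg.
by have [_] := sA 0%N isT; rewrite /= in_itv/= andbT => /ltW.
Qed.

(** Interpolate at N points of A with gaps g = kappa h / (2 N), the largest gap
    that the measure of A guarantees up to a factor.  The sum of the Lagrange
    basis is then at most (4 N / kappa)^(N-1) / (N-1)!, and the power of N is
    compensated by the factorial up to e^N. *)
Lemma line_propagation (G : nat -> R -> R) N (A : set R) (a h kappa D eta x : R) :
    (0 < N)%N -> 0 < h -> 0 < kappa <= 1 -> 0 <= eta ->
    (forall k t, (k < N)%N -> in_co a (a + h) t -> is_derive t 1 (G k) (G k.+1 t)) ->
    (forall t, in_co a (a + h) t -> `|G N t| <= D) ->
    measurable A -> (forall t, A t -> in_co a (a + h) t) ->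
    ((kappa * h)%:E <= lambda A)%E ->
    (forall t, A t -> `|G 0%N t| <= eta) ->
    in_co a (a + h) x ->
  `|G 0%N x| <= (4 * expR 1 / kappa) ^+ N * eta + D * h ^+ N / N`!%:R.
Proof.
case: N => // m _ h0 /andP[k0 k1] eta0 dG GD mA Aah lA Aeta xah.
pose g := kappa * h / (2 * m.+1%:R).
have m0 : (0 : R) < m.+1%:R by rewrite ltr0n.
have g0 : 0 < g by rewrite divr_gt0 ?mulr_gt0.
have [||t [tA tg]] := @separated_points A a g m mA _ g0.
- by move=> t /Aah /andP[]; rewrite /= in_itv/= andbT.
- apply: lt_le_trans lA; rewrite lte_fin /g -muln2 natrM.
  rewrite mulrA ltr_pdivrMr ?mulr_gt0// mulrC ltr_pM2l ?mulr_gt0//.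
  by rewrite mulrC ltr_pM2l// ltr_nat.
have tinj : forall k l : 'I_m.+1, t k = t l -> k = l.
  move=> k l tkl; apply: val_inj; apply/eqP/negPn/negP => /=.
  rewrite neq_ltn => /orP[] kl.
    have := separated_dist t m g k l tg; rewrite tkl subrr (ltnW kl) -ltnS ltn_ord.
    by move=> /(_ isT); rewrite leNgt mulr_gt0// ltr0n subn_gt0.
  have := separated_dist t m g l k tg; rewrite tkl subrr (ltnW kl) -ltnS ltn_ord.
  by move=> /(_ isT); rewrite leNgt mulr_gt0// ltr0n subn_gt0.
pose q := \sum_(j < m.+1) G 0%N (t j) *: lagrange_basis t m j.
have At (j : 'I_m.+1) : A (t j) by apply: tA; rewrite -ltnS.
have qE i : q.[t (i : 'I_m.+1)] = G 0%N (t i).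
  rewrite horner_sum (bigD1 i)//= hornerZ lagrange_basis_sample// eqxx mulr1.
  rewrite big1 ?addr0// => j ji; rewrite hornerZ lagrange_basis_sample//.
  by rewrite eq_sym (negbTE ji) mulr0.
have [|||||u uah] := @interpolation_error R G m.+1 a (a + h)
    [seq t i | i : 'I_m.+1] q x dG _ _ _ _ _ xah.
- by rewrite size_map -cardE card_ord.
- by rewrite map_inj_uniq ?enum_uniq.
- by apply/allP => _ /mapP[j _ ->]; exact: Aah.
- rewrite (leq_trans (size_sum _ _ _))//; apply/bigmax_leqP => j _.
  by rewrite (leq_trans (size_scale_leq _ _))// size_lagrange_basis.
- by apply/allP => _ /mapP[j _ ->]; rewrite qE.
have xt y : in_co a (a + h) y -> `|x - y| <= h.
  by move: xah => /andP[? ?] /andP[? ?]; rewrite ler_norml; lra.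
rewrite big_map big_enum/= => /eqP; rewrite subr_eq => /eqP ->; rewrite addrC.
rewrite (le_trans (ler_normD _ _))// lerD//.
  rewrite horner_sum (le_trans (ler_norm_sum _ _ _))//.
  apply: (@le_trans _ _ (\sum_(j < m.+1) `|(lagrange_basis t m j).[x]| * eta)).
    apply: ler_sum => j _; rewrite hornerZ normrM mulrC ler_wpM2l//.
    exact/Aeta/At.
  rewrite -mulr_suml ler_wpM2r//.
  have Lb := @lagrange_basis_bound R t m g h x g0 tg _.
  rewrite (le_trans (Lb _))//; first by move=> i im; apply/xt/Aah/tA.
  have -> : 2 * (h / g) = 4 / kappa * m.+1%:R by rewrite /g; field; lra.
  apply: (@le_trans _ _ ((4 / kappa) ^+ m * expR 1 ^+ m)).
    rewrite (exprMn m (4 / kappa)) -(mulrA ((4 / kappa) ^+ m)).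
    by rewrite ler_wpM2l ?natSXn_le// exprn_ge0// divr_ge0// ltW.
  rewrite -exprMn mulrAC exprS ler_peMl ?exprn_ge0//.
    by rewrite divr_ge0 ?mulr_ge0 ?expR_ge0// ltW.
  rewrite ler_pdivlMr// mul1r (le_trans k1)//.
  by have := expR_ge1Dx (1 : R); lra.
rewrite !normrM normfV normr_nat mulrAC ler_wpM2r// ler_pM ?GD// normr_prod.
rewrite -[in leRHS](card_ord m.+1) -prodr_const; apply: ler_prod => i _.
by rewrite normr_ge0/= xt//; exact: Aah.
Qed.

End propagation.

(** * Propagation of smallness in a cube *)

Section boxes.
Context {R : realType}.
Local Notation lambda := (@lebesgue_measure R).
Local Notation mu := (borel_lebesgue R).
Implicit Types (n : nat) (h : R).

Definition box n (c : 'rV[R]_n) h : set 'rV[R]_n :=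
  [set x | forall i, in_co (c 0 i) (c 0 i + h) (x 0 i)].

(** Convertible to [cons_rV], but between plain rows: the aliases that carry the
    sigma-algebras would block rewriting. *)
Definition cons_row n (t : R) (v : 'rV[R]_n) : 'rV[R]_n.+1 :=
  row_mx t%:M v : 'rV[R]_(1 + n).

Lemma cons_row0 n t (v : 'rV[R]_n) : cons_row n t v 0 0 = t.
Proof.
transitivity (row_mx t%:M v 0 (lshift n 0)); last by rewrite row_mxEl mxE.
by congr (row_mx _ _ _ _); exact: val_inj.
Qed.

Lemma cons_rowS n t (v : 'rV[R]_n) (i : 'I_n) : cons_row n t v 0 (lift 0 i) = v 0 i.
Proof.
transitivity (row_mx t%:M v 0 (rshift 1 i)); last by rewrite row_mxEr.
by congr (row_mx _ _ _ _); exact: val_inj.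
Qed.

Definition row_tail n (x : 'rV[R]_n.+1) : 'rV[R]_n := \row_i x 0 (lift 0 i).

Lemma cons_row_tail n (x : 'rV[R]_n.+1) : cons_row n (x 0 0) (row_tail n x) = x.
Proof.
apply/rowP => i; case: (unliftP 0 i) => [j|] ->; first by rewrite cons_rowS mxE.
by rewrite cons_row0.
Qed.

Lemma box_cons n (c : 'rV[R]_n.+1) h t (v : 'rV[R]_n) :
  box n.+1 c h (cons_row n t v) <->
  in_co (c 0 0) (c 0 0 + h) t /\ box n (row_tail n c) h v.
Proof.
split=> [cv|[ct cv] i].
  split; first by have := cv 0; rewrite cons_row0.
  by move=> i; have := cv (lift 0 i); rewrite cons_rowS mxE.
case: (unliftP 0 i) => [j|] ->; last by rewrite cons_row0.
by rewrite cons_rowS; have := cv j; rewrite mxE.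
Qed.

Lemma in_coE (a b : R) : [set t | in_co a b t] = `[a, b[%classic.
Proof. by apply/seteqP; split => t /=; rewrite in_itv. Qed.

Lemma measurable_in_co (a b : R) :
  measurable ([set t | in_co a b t] : set (measurableTypeR R)).
Proof. by rewrite in_coE; exact: measurable_itv. Qed.

Lemma lebesgue_in_co (a h : R) : 0 < h -> lambda [set t | in_co a (a + h) t] = h%:E.
Proof.
move=> h0; rewrite in_coE lebesgue_measure_itv/= lte_fin ifT; last by lra.
by rewrite -EFinD; congr EFin; ring.
Qed.

Lemma measurable_box n (c : 'rV[R]_n) h : measurable (box n c h : set (borel_rV R n)).
Proof.
have -> : box n c h = \bigcap_(i in [set: 'I_n])
    [set x : 'rV[R]_n | in_co (c 0 i) (c 0 i + h) (x 0 i)].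
  by apply/seteqP; split => [x bx i _|x bx i]; exact: bx.
apply: fin_bigcap_measurable => // i _.
have := @measurable_coord R n i measurableT _ (measurable_in_co (c 0 i) (c 0 i + h)).
by rewrite setTI.
Qed.

Lemma measurable_cons_preimage n (A : set (borel_rV R n.+1)) :
  measurable A -> measurable (cons_rV @^-1` A).
Proof.
by move=> mA; rewrite -[X in measurable X]setTI; exact: measurable_cons_rV.
Qed.

Lemma measure_box n (c : 'rV[R]_n) h : 0 < h -> mu n (box n c h) = (h ^+ n)%:E.
Proof.
move=> h0; elim: n c => [|n IH] c.
  rewrite /= diracE mem_set//; by move=> [].
rewrite /= /lebesgue_prod /pushforward.
have -> : cons_rV @^-1` box n.+1 c h =
    [set t | in_co (c 0 0) (c 0 0 + h) t] `*` box n (row_tail n c) h.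
  apply/seteqP; split => -[t v] /= /box_cons //.
rewrite product_measure1E; [|exact: measurable_in_co|exact: measurable_box].
by rewrite [X in (X * _)%E]lebesgue_in_co// IH exprS.
Qed.

Definition row_with n (x : 'rV[R]_n) (i : 'I_n) (t : R) : 'rV[R]_n :=
  \row_j (if j == i then t else x 0 j).

Lemma row_with_cons0 n t s (v : 'rV[R]_n) :
  row_with n.+1 (cons_row n t v) 0 s = cons_row n s v.
Proof.
apply/rowP => j; rewrite mxE; case: (unliftP 0 j) => [k|] ->.
  by rewrite !cons_rowS.
by rewrite eqxx cons_row0.
Qed.

Lemma row_with_consS n t s (v : 'rV[R]_n) i :
  row_with n.+1 (cons_row n t v) (lift 0 i) s = cons_row n t (row_with n v i s).
Proof.
apply/rowP => j; rewrite mxE; case: (unliftP 0 j) => [k|] ->.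
  by rewrite !cons_rowS mxE (inj_eq lift_inj).
by rewrite !cons_row0.
Qed.

(** What [line_propagation] provides along the axes, with no mention of
    derivatives: the property passes to slices of f, which is all that the
    induction on the dimension uses. *)
Definition propagates n (f : 'rV[R]_n -> R) (c : 'rV[R]_n) (h kappa L tau : R) :=
  forall x (i : 'I_n) (A : set R) eta, box n c h x -> measurable A ->
    (forall t, A t -> in_co (c 0 i) (c 0 i + h) t) ->
    ((kappa * h)%:E <= lambda A)%E -> 0 <= eta ->
    (forall t, A t -> `|f (row_with n x i t)| <= eta) ->
  forall t, in_co (c 0 i) (c 0 i + h) t -> `|f (row_with n x i t)| <= L * eta + tau.

(** Were the set of good t of measure less than kappa h, Fubini's theorem would
    bound the measure of A by h^n times that measure plus the contribution
    (n+1) kappa h^n h of the other slices, which is less than assumed. *)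
Lemma large_slices n (c : 'rV[R]_n.+1) (h kappa : R) (A : set (borel_rV R n.+1)) :
    0 < h -> 0 < kappa -> measurable A -> A `<=` box n.+1 c h ->
    ((n.+2%:R * kappa * h ^+ n.+1)%:E <= mu n.+1 A)%E ->
  exists B : set R, [/\ measurable B,
    forall t, B t -> in_co (c 0 0) (c 0 0 + h) t,
    ((kappa * h)%:E <= lambda B)%E &
    forall t, B t ->
      ((n.+1%:R * kappa * h ^+ n)%:E <= mu n (xsection (cons_rV @^-1` A) t))%E].
Proof.
move=> h0 k0 mA Ac lA.
pose I := [set t | in_co (c 0 0) (c 0 0 + h) t].
pose g t := mu n (xsection (cons_rV @^-1` A) t).
pose be := n.+1%:R * kappa * h ^+ n.
have mg : measurable_fun [set: measurableTypeR R] g.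
  by apply: measurable_fun_xsection; exact: measurable_cons_preimage.
pose B := I `&` g @^-1` `[be%:E, +oo[.
have mI : measurable (I : set (measurableTypeR R)) by exact: measurable_in_co.
have mB : measurable (B : set (measurableTypeR R)).
  apply: measurableI => //; rewrite -[X in measurable X]setTI; apply: mg => //.
  exact: emeasurable_itv.
have hn0 : 0 <= h ^+ n by rewrite exprn_ge0// ltW.
have be0 : 0 <= be by rewrite mulr_ge0// mulr_ge0// ltW.
exists B; split => //; first by move=> t [].
  have gI t : (g t <= (h ^+ n * \1_B t + be * \1_I t)%:E)%E.
    have [It|It] := pselect (I t); last first.
      suff -> : g t = 0%E.
        by rewrite lee_fin addr_ge0// mulr_ge0// indicE.
      rewrite /g (_ : xsection _ _ = set0) ?measure0//.
      by rewrite -subset0 => v; rewrite xsectionE => /Ac/box_cons[].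
    have gh : (g t <= (h ^+ n)%:E)%E.
      rewrite -(measure_box n (row_tail n c) h h0); apply: le_measure.
      - rewrite inE; apply: measurable_xsection; exact: measurable_cons_preimage.
      - rewrite inE; exact: measurable_box.
      - by move=> v; rewrite xsectionE => /Ac/box_cons[].
    rewrite !indicE (mem_set It) mulr1; case: (boolP (t \in B)) => tB.
      by rewrite mulr1 (le_trans gh)// lee_fin lerDl.
    rewrite mulr0 add0r leNgt; apply: contra tB => /ltW gbe; rewrite inE.
    by split => //=; rewrite in_itv/= gbe.
  have lI : lambda I = h%:E by exact: lebesgue_in_co.
  have lBoo : lambda B \is a fin_num.
    rewrite ge0_fin_numE// (le_lt_trans _ (ltry h))// -lI.
    by apply: le_measure; rewrite ?inE// => t [].
  have mi (C : set (measurableTypeR R)) (k : R) : measurable C -> 0 <= k ->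
      measurable_fun [set: measurableTypeR R] (fun t => (k * \1_C t)%:E).
    by move=> mC _; apply/measurable_EFinP/measurable_funM => //; exact: measurable_indic.
  have ii (C : set (measurableTypeR R)) (k : R) : measurable C -> 0 <= k ->
      (\int[lambda]_t (k * \1_C t)%:E = k%:E * lambda C)%E.
    move=> mC k0'; under eq_integral do rewrite EFinM.
    rewrite ge0_integralZl_EFin//; last exact/measurable_EFinP/measurable_indic.
    by rewrite integral_indic// setIT.
  have : (mu n.+1 A <= (h ^+ n)%:E * lambda B + be%:E * lambda I)%E.
    rewrite /= /lebesgue_prod /pushforward /product_measure1.
    have i0 (C : set (measurableTypeR R)) (k : R) t : 0 <= k -> (0 <= (k * \1_C t)%:E)%E.
      by move=> ?; rewrite lee_fin mulr_ge0// indicE.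
    rewrite -!ii// -(ge0_integralD lebesgue_measure measurableT
      (fun t _ => i0 B _ t hn0) (mi B _ mB hn0) (fun t _ => i0 I _ t be0) (mi I _ mI be0)).
    apply: ge0_le_integral => //.
      by apply: emeasurable_funD; exact: mi.
  move/(le_trans lA); rewrite lI -(fineK lBoo) -!EFinM -EFinD !lee_fin /be.
  rewrite exprS -[n.+2]addn1 natrD.
  have : 0 < h ^+ n by rewrite exprn_gt0.
  move=> hn le1; rewrite -(ler_pM2l hn); move: le1; nra.
by move=> t [_]; rewrite /= in_itv/= => /andP[].
Qed.

(** By induction f is small on the slices provided by [large_slices], on which A
    has kept a proportion (n+1) kappa; these slices meet every line parallel to
    the first axis in the same set B, of measure at least kappa h, so that one
    more propagation along these lines reaches the whole box.  The proportion
    decreases by kappa at each step and is still kappa in dimension 0, where it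
    says that A is not empty. *)
Lemma box_propagation n (f : 'rV[R]_n -> R) c h kappa L tau eta A :
    0 < h -> 0 < kappa -> 0 <= L -> 0 <= tau -> 0 <= eta ->
    propagates n f c h kappa L tau ->
    measurable (A : set (borel_rV R n)) -> A `<=` box n c h ->
    ((n.+1%:R * kappa * h ^+ n)%:E <= mu n A)%E ->
    (forall x, A x -> `|f x| <= eta) ->
  forall x, box n c h x -> `|f x| <= iter n (fun e => L * e + tau) eta.
Proof.
move=> h0 k0 L0 tau0 eta0; elim: n f c A => [|n IH] f c A pf mA Ac lA Af x cx.
  have [A0|/set0P[y Ay]] := eqVneq A set0.
    by move: lA; rewrite A0 measure0 lee_fin expr0 mulr1 mul1r leNgt k0.
  by rewrite (_ : x = y) ?Af//; apply/rowP => -[].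
have [B [mB Bc lB BA]] := large_slices n c h kappa A h0 k0 mA Ac lA.
have it0 k : 0 <= iter k (fun e => L * e + tau) eta.
  by elim: k => //= k IHk; rewrite addr_ge0// mulr_ge0.
move: cx; rewrite -(cons_row_tail n x); move: (x 0 0) (row_tail n x) => t v.
move=> /[dup] cx /box_cons[ct cv].
have := pf _ 0 B (iter n (fun e => L * e + tau) eta) cx mB Bc lB (it0 n).
rewrite -[X in _ -> `|f X| <= _](row_with_cons0 n t); apply => // s Bs.
rewrite row_with_cons0.
apply: (IH (fun w => f (cons_row n s w)) (row_tail n c)
  (xsection (cons_rV @^-1` A) s)) => //.
- move=> w i D e cw mD Dc lD e0 De r ci.
  have cE : row_tail n c 0 i = c 0 (lift 0 i) by rewrite mxE.
  rewrite cE in Dc ci; rewrite -row_with_consS; apply: (pf _ _ D e) => //.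
    by apply/box_cons; split => //; exact: Bc.
  by move=> q Dq; rewrite row_with_consS; exact: De.
- by apply: measurable_xsection; exact: measurable_cons_preimage.
- by move=> w; rewrite xsectionE => /Ac/box_cons[].
- exact: BA.
- by move=> w; rewrite xsectionE => /Af.
Qed.

End boxes.

(** * Dyadic cells *)

Section cells.
Context {R : realType} {n : nat}.
Local Notation mu := (borel_lebesgue R n).
Implicit Types (m : nat) (x y : 'rV[R]_n) (U V A : set 'rV[R]_n).

Definition cell m x : 'rV[int]_n := \row_i Num.floor (2 ^+ m * x 0 i).

Definition cell_corner m (k : 'rV[int]_n) : 'rV[R]_n := \row_i ((k 0 i)%:~R / 2 ^+ m).

Lemma cellE m k : [set x | cell m x = k] = box n (cell_corner m k) (2 ^+ m)^-1.
Proof.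
have p0 : (0 : R) < 2 ^+ m by rewrite exprn_gt0.
have eqf (z : R) (j : int) : (Num.floor (2 ^+ m * z) == j) =
    in_co (j%:~R / 2 ^+ m) (j%:~R / 2 ^+ m + (2 ^+ m)^-1) z.
  have -> : j%:~R / 2 ^+ m + (2 ^+ m)^-1 = (j + 1)%:~R / 2 ^+ m :> R.
    by rewrite intrD mulrDl mul1r.
  by rewrite floor_eq /in_co ler_pdivrMr// ltr_pdivlMr// mulrC.
apply/seteqP; split => x /=.
  by move=> xk i; rewrite mxE -eqf -xk mxE.
by move=> xb; apply/rowP => i; rewrite mxE; apply/eqP; rewrite eqf; have := xb i; rewrite mxE.
Qed.

Lemma measurable_cell m k : measurable ([set x | cell m x = k] : set (borel_rV R n)).
Proof. by rewrite cellE; exact: measurable_box. Qed.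

Lemma measure_cell m k : mu [set x | cell m x = k] = ((2 ^+ m)^-1 ^+ n)%:E.
Proof. by rewrite cellE measure_box// invr_gt0 exprn_gt0. Qed.

(** floor (2 s) determines floor s. *)
Lemma cell_refine m x y : cell m.+1 y = cell m.+1 x -> cell m y = cell m x.
Proof.
move=> yx; apply/rowP => i; have := congr1 (fun k : 'rV[int]_n => k 0 i) yx.
rewrite !mxE exprS -!mulrA; move: (_ * x _ _) (_ * y _ _) => {yx}s t ts.
have /andP[s1 s2] := floor_itv s; have /andP[S1 S2] := floor_itv (2 * s).
have /andP[T1 T2] := floor_itv (2 * t); rewrite ts in T1 T2.
apply/eqP; rewrite floor_eq; set p := Num.floor s in s1 s2 *.
set q := Num.floor (2 * s) in S1 S2 T1 T2.
have pq : 2 * p <= q.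
  by rewrite floor_ge_int intrM ler_pM2l.
have qp : q + 1 <= 2 * (p + 1).
  suff : q < 2 * (p + 1) by lia.
  by rewrite floor_lt_int intrM ltr_pM2l.
move: pq qp; rewrite -(ler_int R) -[q + 1 <= _](ler_int R) !intrM.
move=> pq qp; apply/andP; split; lra.
Qed.

Lemma cell_coarsen m m' x y : (m <= m')%N -> cell m' y = cell m' x -> cell m y = cell m x.
Proof.
by move=> /subnK <-; elim: (m' - m)%N => [//|j IH]; rewrite addSn => /cell_refine/IH.
Qed.

Lemma exp2V_le (e : R) : 0 < e -> exists m0, forall m, (m0 <= m)%N -> (2 ^+ m)^-1 <= e.
Proof.
move=> e0; exists (Num.trunc e^-1).+1 => m m0m.
rewrite -[leRHS]invrK lef_pV2 ?posrE ?invr_gt0 ?exprn_gt0//.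
rewrite (le_trans (ltW (truncnS_gt _)))// -natrX ler_nat (leq_trans m0m)//.
exact/ltnW/ltn_expl.
Qed.

Lemma nbhs_cell x U : nbhs x U -> exists m, forall y, cell m y = cell m x -> U y.
Proof.
move/nbhs_ballP => [e /= e0 xU]; have [m mh] := exp2V_le e e0; exists m => y yx.
apply: xU; split => // i j; rewrite ord1.
have cy : [set z | cell m z = cell m x] y by [].
have cx : [set z | cell m z = cell m x] x by [].
have := mh m (leqnn m); move: cx cy; rewrite cellE => /(_ j) + /(_ j).
rewrite /ball/= /in_co => /andP[x1 x2] /andP[y1 y2] he.
by rewrite ltr_norml; lra.
Qed.

(** The union of the cells of side 2^-m that are contained in U. *)
Definition inner m U : set 'rV[R]_n := [set x | forall y, cell m y = cell m x -> U y].

Lemma inner_sub m U : inner m U `<=` U.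
Proof. by move=> x; apply. Qed.

Lemma inner_homo U : {homo inner^~ U : m m' / (m <= m')%N >-> (m <= m')%O}.
Proof.
by move=> m m' mm'; apply/subsetPset => x xU y yx; exact/xU/(cell_coarsen _ _ _ _ mm').
Qed.

Lemma bigcup_inner U : open U -> \bigcup_m inner m U = U.
Proof.
move=> oU; apply/seteqP; split => [x [m _]|x Ux]; first exact: inner_sub.
by have [m mU] := nbhs_cell x U (open_nbhs_nbhs (conj oU Ux)); exists m.
Qed.

Lemma measurable_inner m U : measurable (inner m U : set (borel_rV R n)).
Proof.
have -> : inner m U = \bigcup_(k : 'rV[int]_n) (inner m U `&` [set x | cell m x = k]).
  apply/seteqP; split => [x xU|x [k _ []]//].
  by exists (cell m x).
apply: countable_bigcupT_measurable => [|k]; first exact: countableP.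
have [->|/set0P[x [xU xk]]] := eqVneq (inner m U `&` [set x | cell m x = k]) set0.
  exact: measurable0.
rewrite (_ : _ `&` _ = [set x | cell m x = k]); first exact: measurable_cell.
apply/seteqP; split => [y []//|y yk]; split => // z zy.
by apply: xU; rewrite zy yk xk.
Qed.

(** The sigma-algebra is generated by coordinates; open sets belong to it as
    countable unions of cells. *)
Lemma open_measurable_rV U : open U -> measurable (U : set (borel_rV R n)).
Proof.
move=> /bigcup_inner <-; apply: bigcupT_measurable => m; exact: measurable_inner.
Qed.

(** Pigeonhole principle: if A filled every cell of U in a proportion less than
    theta, summation over these countably many disjoint cells would contradict
    the hypothesis. *)
Lemma dense_cell m U A (theta : R) : 0 <= theta -> measurable (A : set (borel_rV R n)) ->
    (theta%:E * mu (inner m U) < mu (A `&` inner m U))%E ->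
  exists2 k, [set x | cell m x = k] `<=` U &
    ((theta * (2 ^+ m)^-1 ^+ n)%:E <= mu (A `&` [set x | cell m x = k]))%E.
Proof.
move=> th0 mA; apply: contraPP => noQ; apply/negP; rewrite -leNgt.
pose F i : set (borel_rV R n) := if pickle_inv i is Some k
  then inner m U `&` [set x | cell m x = k] else set0.
have UF : inner m U = \bigcup_i F i.
  apply/seteqP; split => [x xU|x [i _]].
    by exists (pickle (cell m x)) => //; rewrite /F pickleK_inv.
  by rewrite /F; case: pickle_inv => // k [].
have FE i : F i = set0 \/
    exists2 k, F i = [set x | cell m x = k] & [set x | cell m x = k] `<=` U.
  rewrite /F; case: pickle_inv => [k|]; last by left.
  have [->|/set0P[x [xU xk]]] := eqVneq (inner m U `&` [set x | cell m x = k]) set0.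
    by left.
  right; exists k => [|y yk]; last by apply: xU; rewrite yk.
  apply/seteqP; split => [y []//|y yk]; split => // z zy.
  by apply: xU; rewrite zy yk xk.
have mF i : measurable (F i).
  by have [->|[k -> _]] := FE i; [exact: measurable0|exact: measurable_cell].
have tF : trivIset setT F.
  apply/trivIsetP => i j _ _; apply: contra_neqP => /eqP/set0P[x []]; rewrite /F.
  case Ei: (pickle_inv i) => [k|//] [_ xk]; case Ej: (pickle_inv j) => [l|//] [_ xl].
  have := @pickle_invK 'rV[int]_n i; have := @pickle_invK 'rV[int]_n j.
  by rewrite /oapp Ei Ej => <- <-; rewrite -xk -xl.
rewrite UF setI_bigcupr measure_bigcup//; last 2 first.
- by move=> i _; exact: measurableI.
- by apply: trivIset_setIl.
rewrite measure_bigcup// -nneseriesZl//.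
apply: lee_nneseries => // i _.
have [->|[k -> kU]] := FE i; first by rewrite setI0 measure0 mule0.
have lk : (mu (A `&` [set x | cell m x = k]) <= theta%:E * mu [set x | cell m x = k])%E.
  rewrite measure_cell -EFinM leNgt; apply/negP => /ltW lk; apply: noQ.
  by exists k.
exact: lk.
Qed.

Lemma mu_nonempty_gt0 x U : nbhs x U -> measurable (U : set (borel_rV R n)) -> (0 < mu U)%E.
Proof.
move=> /nbhs_cell[m mU] mUU.
apply: (@lt_le_trans _ _ (mu [set y | cell m y = cell m x])).
  by rewrite measure_cell lte_fin exprn_gt0// invr_gt0 exprn_gt0.
by apply: le_measure; rewrite ?inE//; exact: measurable_cell.
Qed.

End cells.

(** * Essential suprema *)

Section Linfty.
Context {R : realType} {n : nat}.
Local Notation mu := (borel_lebesgue R n).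
Local Notation leb := (@lebesgue_rV R n).
Implicit Types (A B D N : set 'rV[R]_n) (f : 'rV[R]_n -> R).

Lemma lebesgue_rVE A : measurable (A : set (borel_rV R n)) -> leb A = mu A.
Proof. by move=> mA; exact: measurable_mu_extE. Qed.

Lemma le_lebesgue_rV A B : A `<=` B -> (leb A <= leb B)%E.
Proof. by move=> AB; exact: (le_outer_measure (mu^*)%mu). Qed.

(** [lebesgue_rV] is the value of an outer measure, subadditive on arbitrary
    sets. *)
Lemma lebesgue_rV_null A B N : leb N = 0%E -> A `<=` B `|` N -> (leb A <= leb B)%E.
Proof.
move=> N0 ABN; apply: (le_trans (le_lebesgue_rV _ _ ABN)).
apply: (le_trans (outer_measureU2 (mu^*)%mu B N)).
suff : (leb B + leb N <= leb B)%E by [].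
by rewrite N0 adde0.
Qed.

Lemma lebesgue_rV_setT_gt0 : (0 < leb [set: 'rV[R]_n])%E.
Proof.
apply: lt_le_trans (le_lebesgue_rV _ _ (@subsetT _ (box n 0 1))).
rewrite lebesgue_rVE; last exact: measurable_box.
by rewrite measure_box// expr1n.
Qed.

Lemma Linfty_norm_le D f (s : R) : 0 <= s -> (forall x, D x -> `|f x| <= s) ->
  (Linfty_norm D f <= s%:E)%E.
Proof.
move=> s0 fs; rewrite /Linfty_norm unlock; case: ifP => _; last by rewrite lee_fin.
apply/ess_supP; apply: nearW => x /=; rewrite patchE; case: ifPn => [|_].
  by rewrite inE => /fs; rewrite lee_fin.
by rewrite normr0 lee_fin.
Qed.

Lemma Linfty_norm_ae D f : exists2 N, leb N = 0%E &
  forall x, D x -> ~ N x -> (`|f x|%:E <= Linfty_norm D f)%E.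
Proof.
have [N [_ N0 hN]] := ess_sup_ge leb (abse \o (EFin \o f \_ D)).
exists N => // x Dx Nx; rewrite /Linfty_norm unlock lebesgue_rV_setT_gt0.
apply: contrapT => h; apply: Nx; apply: hN => /=.
by move: h; rewrite patchE mem_set.
Qed.

Lemma open_superlevel D f (r : R) : open D -> (forall x, D x -> {for x, continuous f}) ->
  open [set x | D x /\ r < `|f x|].
Proof.
move=> oD cf; rewrite openE => x [Dx rx] /=; rewrite /interior/=.
near=> y; split; first by near: y; exact: open_nbhs_nbhs.
by near: y; have /cvgr_norm_gt := cf x Dx; exact.
Unshelve. all: by end_near. Qed.

(** If |f x| exceeded the essential supremum, so would |f| on a nonempty open
    set, which contains a cell and so has positive measure. *)
Lemma Linfty_norm_pointwise D f x : open D ->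
  (forall y, D y -> {for y, continuous f}) -> D x -> (`|f x|%:E <= Linfty_norm D f)%E.
Proof.
move=> oD cf Dx; rewrite leNgt; apply/negP => Lf.
have [r Lr rf] : exists2 r : R, (Linfty_norm D f <= r%:E)%E & r < `|f x|.
  move: Lf; case: (Linfty_norm D f) => [r| |] //; rewrite ?lte_fin => Lf.
    by exists r.
  by exists (`|f x| - 1); [exact: leNye|rewrite ltrBlDr ltrDl].
have oU := open_superlevel D f r oD cf.
have : (0 < mu [set y | D y /\ (r < `|f y|)%R])%E.
  apply: (mu_nonempty_gt0 x); last exact: open_measurable_rV.
  exact: open_nbhs_nbhs.
have [N N0 hN] := Linfty_norm_ae D f.
apply/negP; rewrite -leNgt -lebesgue_rVE; last exact: open_measurable_rV.
rewrite -N0; apply: le_lebesgue_rV => y [Dy ry]; apply: contrapT => Ny.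
by have := le_trans (hN y Dy Ny) Lr; rewrite lee_fin leNgt ry.
Qed.

Lemma eball_coord (x y : 'rV[R]_n) (r : R) i : eball x r y -> `|y 0 i - x 0 i| < r.
Proof.
apply: le_lt_trans; rewrite /enorm -sqrtr_sqr ler_wsqrtr//.
by rewrite (bigD1 i)//= !mxE lerDl sumr_ge0// => j _; rewrite sqr_ge0.
Qed.

End Linfty.

(** * Smooth functions on lines and cubes *)

Section lines.
Context {R : realType} {n : nat}.
Implicit Types (f : 'rV[R]_n -> R) (i : 'I_n).

(** The only multi-indices used are N times a unit vector, for which the nested
    partial derivatives of [mderiv] reduce to an iterated one. *)
Lemma mderiv_pure i N f :
  mderiv (fun j => if j == i then N else 0%N) f = pderivs (nseq N i) f.
Proof.
have pureE s : uniq s ->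
    foldr (fun j => iter (if j == i then N else 0%N) (pderiv j)) f s =
    if i \in s then pderivs (nseq N i) f else f.
  elim: s => //= j s IH /andP[js us]; rewrite IH// in_cons eq_sym.
  have [ji|ij]//= := eqVneq; rewrite -ji in js *.
  rewrite (negbTE js) /pderivs.
  by elim: (N) => //= k ->.
by rewrite /mderiv pureE ?enum_uniq// mem_enum.
Qed.

Lemma mlength_pure i N : mlength (fun j : 'I_n => if j == i then N else 0%N) = N.
Proof.
by rewrite /mlength (bigD1 i)//= eqxx big1 ?addn0// => j /negbTE ->.
Qed.

Lemma is_derive_row_with f (x : 'rV[R]_n) i (t : R) :
    derivable f (row_with n x i t) (delta_mx 0 i) ->
  is_derive t 1 (fun s => f (row_with n x i s)) (pderiv i f (row_with n x i t)).
Proof.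
move=> df.
have E : (fun h : R => h^-1 *: ((f (row_with n x i (h *: 1 + t))) - f (row_with n x i t))) =
    (fun h : R => h^-1 *:
      ((f \o shift (row_with n x i t)) (h *: delta_mx 0 i) - f (row_with n x i t))).
  apply/funext => h; congr (_ *: (f _ - _)); apply/rowP => j.
  by rewrite !mxE /=; case: eqP => _; rewrite ?mulr1n ?mulr0 ?add0r.
by apply: DeriveDef; rewrite /derivable /pderiv /derive/= E.
Qed.

Lemma propagates_smooth f c (h kappa Mf : R) N :
    (0 < N)%N -> 0 < h -> 0 < kappa <= 1 -> Cinfty_on (box n c h) f ->
    (forall i x, box n c h x -> `|pderivs (nseq N i) f x| <= Mf) ->
  propagates n f c h kappa ((4 * expR 1 / kappa) ^+ N) (Mf * h ^+ N / N`!%:R).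
Proof.
move=> N0 h0 k01 sf fM x i A eta cx mA Ac lA eta0 Aeta t ct.
have cxt s : in_co (c 0 i) (c 0 i + h) s -> box n c h (row_with n x i s).
  by move=> cs j; rewrite mxE; case: eqP => [->//|_]; exact: cx.
apply: (@line_propagation R (fun k s => pderivs (nseq k i) f (row_with n x i s))
  N A (c 0 i) h kappa Mf eta t) => //.
- move=> k s kN cs; apply: is_derive_row_with.
  have sk : (size (nseq k i) < k.+1)%N by rewrite size_nseq.
  have [_ dk] := sf k.+1 (nseq k i) (ltnW sk) _ (cxt s cs).
  exact: dk.
- by move=> s cs; apply: fM; exact: cxt.
Qed.

Lemma iter_affine_le (L tau eta : R) k : 1 <= L -> 0 <= tau -> 0 <= eta ->
  iter k (fun e => L * e + tau) eta <= L ^+ k * (eta + k%:R * tau).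
Proof.
move=> L1 tau0 eta0; elim: k => [|k IH]; first by rewrite expr0 mul1r mul0r addr0.
have L0 : 0 <= L by rewrite (le_trans _ L1).
rewrite /= (@le_trans _ _ (L * (L ^+ k * (eta + k%:R * tau)) + tau))//.
  by rewrite lerD2r ler_wpM2l.
rewrite mulrA -exprS -[in leRHS]natr1 mulrDl mul1r addrA [in leRHS]mulrDr lerD2l.
by rewrite ler_peMl// exprn_ege1.
Qed.

(** The error made along one axis is amplified by the propagation along the
    other ones, hence the factor in front of both terms. *)
Lemma smooth_box_bound f c (h kappa Mf eta : R) N (A : set (borel_rV R n)) :
    (0 < N)%N -> 0 < h -> 0 < kappa <= 1 -> 0 <= Mf -> 0 <= eta ->
    Cinfty_on (box n c h) f ->
    (forall i x, box n c h x -> `|pderivs (nseq N i) f x| <= Mf) ->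
    measurable A -> A `<=` box n c h ->
    ((n.+1%:R * kappa * h ^+ n)%:E <= borel_lebesgue R n A)%E ->
    (forall x, A x -> `|f x| <= eta) ->
  forall x, box n c h x -> `|f x| <=
    ((4 * expR 1 / kappa) ^+ N) ^+ n * (eta + n%:R * (Mf * h ^+ N / N`!%:R)).
Proof.
move=> N0 h0 /andP[k0 k1] Mf0 eta0 sf fM mA Ac lA Af x cx.
have L1 : 1 <= (4 * expR 1 / kappa) ^+ N.
  rewrite exprn_ege1// ler_pdivlMr// mul1r (le_trans k1)//.
  by have := expR_ge1Dx (1 : R); lra.
have tau0 : 0 <= Mf * h ^+ N / N`!%:R.
  by rewrite divr_ge0// mulr_ge0// exprn_ge0// ltW.
apply: (le_trans _ (iter_affine_le _ _ _ n L1 tau0 eta0)).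
have prop := propagates_smooth f c h kappa Mf N N0 h0 (introT andP (conj k0 k1)) sf fM.
exact: (box_propagation n f c h kappa _ _ eta A h0 k0 (le_trans ler01 L1) tau0
  eta0 prop mA Ac lA Af x cx).
Qed.

End lines.

(** * Gevrey bounds against the vanishing order *)

Section gevrey.
Context {R : realType}.

(** The left-hand side is the error accumulated over the d coordinates when the
    order of interpolation is N, for cubes of side h, relative to the norm of f.
    Writing s = sigma - 1, the estimate N! <= N^N bounds it by a constant times
    (q h N^s)^N.  The condition sigma < 1 + 1 / b means b s < 1, so that N of
    order h^-b is both large enough for exp (- N) to beat exp (- a / (h/2)^b) and
    small enough for q h N^s to tend to 0 with h. *)
Lemma gevrey_beats_vanishing (d : nat) (K M delta a b sigma : R) :
    (0 < d)%N -> 1 <= K -> 0 < M -> 0 < delta -> 0 < a -> 0 < b -> 1 <= sigma < 1 + 1 / b ->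
  exists2 v, 0 < v & forall h, 0 < h <= v -> exists2 N, (0 < N)%N &
    (K ^+ N) ^+ d * (d%:R * (M * (N`!%:R `^ sigma) / delta ^+ N * h ^+ N / N`!%:R)) <=
    2^-1 * expR (- (a / (h / 2) `^ b)).
Proof.
move=> d0 K1 M0 de0 a0 b0 /andP[s1 s2].
pose s := sigma - 1.
have s0 : 0 <= s by rewrite /s subr_ge0.
have c0 : 0 < 1 - b * s.
  have : s * b < 1 by rewrite -ltr_pdivlMr// /s; lra.
  by rewrite mulrC; lra.
set c := 1 - b * s in c0.
have K0 : 0 < K by rewrite (lt_le_trans _ K1).
have d0' : (0 : R) < d%:R by rewrite ltr0n.
pose q := K ^+ d / delta.
have q0 : 0 < q by rewrite divr_gt0 ?exprn_gt0.
pose P := d%:R * M.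
have P0 : 0 < P by rewrite mulr_gt0.
(* The summand 2 P absorbs the factor P, through P exp (- 2 P) <= 1 / 2. *)
pose T := a * 2 `^ b + 2 * P.
have T0 : 0 < T by rewrite addr_gt0 ?mulr_gt0 ?powR_gt0.
(* h ^ (1 - b s) <= u is what makes q h N^s at most 1 / e. *)
pose u := (expR 1 * q * (T + 1) `^ s)^-1.
have T1 : 0 < T + 1 by rewrite addr_gt0.
have Ts : 0 < (T + 1) `^ s by rewrite powR_gt0.
have u0 : 0 < u by rewrite invr_gt0 mulr_gt0// mulr_gt0 ?expR_gt0.
exists (Num.min 1 (u `^ c^-1)); first by rewrite lt_min ltr01 powR_gt0.
move=> h /andP[h0]; rewrite le_min => /andP[h1 hu].
have hb0 : 0 < h `^ b by rewrite powR_gt0.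
pose H := (h `^ b)^-1.
have H1 : 1 <= H.
  rewrite /H invf_ge1//; have : h `^ b <= 1 `^ b by rewrite ge0_ler_powR ?nnegrE//; exact: ltW.
  by rewrite powR1.
have H0 : 0 < H by rewrite (lt_le_trans _ H1).
pose N := (Num.trunc (T * H)).+1; exists N => //.
have NT : T * H <= N%:R by rewrite ltW// truncnS_gt.
have N0 : (0 : R) < N%:R by rewrite ltr0n.
have NT1 : N%:R <= (T + 1) * H.
  have : (Num.trunc (T * H))%:R <= T * H by rewrite truncn_le ltW// mulr_gt0.
  by rewrite /N -natr1; lra.
(* Only the two bounds on N matter, and N! must not be unfolded. *)
clearbody N.
have f0 : (0 : R) < N`!%:R by rewrite ltr0n fact_gt0.
have small : q * h * N%:R `^ s <= expR (-1).
  have NsH : N%:R `^ s <= (T + 1) `^ s * H `^ s.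
    rewrite -powRM; [|exact: ltW|exact: ltW].
    by rewrite ge0_ler_powR ?nnegrE// ?ltW// mulr_gt0.
  have hH : h * H `^ s <= u.
    have -> : h * H `^ s = h `^ c.
      rewrite /H -powRN -powRrM /c powRD ?powRr1 ?ltW//.
        by congr (_ * h `^ _); ring.
      by rewrite gt_eqF ?implybT.
    have -> : u = (u `^ c^-1) `^ c by rewrite -powRrM mulVf ?gt_eqF// powRr1// ltW.
    by rewrite ge0_ler_powR ?nnegrE ?powR_ge0// ltW.
  have -> : expR (-1) = q * (T + 1) `^ s * u.
    rewrite /u expRN; have := expR_gt0 (1 : R).
    by move: q0 => *; field; rewrite !gt_eqF.
  have -> : q * (T + 1) `^ s * u = q * ((T + 1) `^ s * u) by rewrite mulrA.
  rewrite -mulrA ler_pM2l//.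
  apply: (@le_trans _ _ (h * ((T + 1) `^ s * H `^ s))); first by rewrite ler_pM2l.
  by rewrite mulrCA ler_wpM2l ?powR_ge0.
have factN : N`!%:R `^ s <= (N%:R `^ s) ^+ N.
  rewrite -powR_mulrn ?powR_ge0// -powRrM mulrC powRrM powR_mulrn//.
  rewrite ge0_ler_powR ?nnegrE ?exprn_ge0// -natrX ler_nat.
  rewrite fact_prod -[X in (_ <= _ ^ X)%N](subn0 N) -subSS -prod_nat_const_nat.
  by rewrite big_nat [leqRHS]big_nat; apply: leq_prod => i /andP[].
have -> : (K ^+ N) ^+ d * (d%:R * (M * (N`!%:R `^ sigma) / delta ^+ N * h ^+ N / N`!%:R)) =
    P * ((q * h) ^+ N * N`!%:R `^ s).
  have -> : sigma = 1 + s by rewrite /s; ring.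
  rewrite powRD ?powRr1 ?ltW//; last by rewrite (gt_eqF f0) implybT.
  rewrite /P /q !exprMn -exprM mulnC exprM exprVn.
  have := exprn_gt0 N de0; move: f0 => ? ?; field.
  by rewrite !gt_eqF.
apply: (@le_trans _ _ (P * expR (-1) ^+ N)).
  rewrite ler_pM2l//; apply: (@le_trans _ _ ((q * h * N%:R `^ s) ^+ N)).
    rewrite [leRHS]exprMn ler_pM2l// exprn_gt0// mulr_gt0//.
  by rewrite lerXn2r ?nnegrE ?expR_ge0// mulr_ge0 ?powR_ge0// mulr_ge0// ltW.
rewrite -expRM_natl mulrN1.
have -> : a / (h / 2) `^ b = a * 2 `^ b * H.
  have e2 : 2^-1 `^ b = (2 `^ b)^-1 :> R by rewrite -powR_inv1// -powRrM mulN1r powRN.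
  rewrite powRM ?invr_ge0//; last exact: ltW.
  by rewrite e2 invfM invrK /H; ring.
apply: (@le_trans _ _ (P * expR (- (2 * P) - a * 2 `^ b * H))).
  rewrite ler_pM2l// ler_expR; move: NT; rewrite /T mulrDl.
  have : 2 * P <= 2 * P * H by rewrite ler_peMr// mulr_ge0// ltW.
  by lra.
rewrite expRD mulrA ler_pM2r ?expR_gt0// expRN.
rewrite ler_pdivrMr ?expR_gt0//.
by have := expR_ge1Dx (2 * P); lra.
Qed.

End gevrey.

(** * Propagation from sets of positive measure *)

Section main.
Context {R : realType} {n : nat}.
Implicit Types (Omega E : set 'rV[R]_n.+1) (f : 'rV[R]_n.+1 -> R).
Local Notation mu := (borel_lebesgue R n.+1).
Local Notation leb := (@lebesgue_rV R n.+1).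

Lemma bounded_measure_lty Omega : bounded_set Omega ->
  measurable (Omega : set (borel_rV R n.+1)) -> (mu Omega < +oo)%E.
Proof.
move=> [r [_ rO]] mO.
pose M := `|r| + 1.
have M0 : 0 < M by rewrite ltr_wpDl.
have OM : Omega `<=` box n.+1 (const_mx (- M)) (2 * M + 1).
  move=> x Ox i; rewrite /in_co mxE.
  have /= xM := rO M _ x Ox.
  have : `|x 0 i| <= M.
    apply: le_trans (xM _); last by rewrite (le_lt_trans (ler_norm _))// ltrDl.
    rewrite [leRHS]mx_normrE.
    exact: (@le_bigmax _ _ _ _ (fun ij => `|x ij.1 ij.2|) (0, i)).
  by rewrite ler_norml => /andP[? ?]; apply/andP; split; lra.
apply: (@le_lt_trans _ _ (mu (box n.+1 (const_mx (- M)) (2 * M + 1)))).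
  by apply: le_measure; rewrite ?inE//; exact: measurable_box.
by rewrite measure_box ?ltry//; lra.
Qed.

(** f is bounded on a small ball around x by continuity, and the lower bound on
    balls transfers this to Omega. *)
Lemma Linfty_norm_fin_num Omega f a b r0 x : open Omega -> Cinfty_on Omega f ->
    0 < r0 -> Omega x ->
    (forall (r : R) (x : 'rV[R]_n.+1), 0 < r <= r0 -> Omega x ->
      (Linfty_norm Omega f <=
       (expR (a / r `^ b))%:E * Linfty_norm (eball x r `&` Omega) f)%E) ->
  Linfty_norm Omega f \is a fin_num.
Proof.
move=> oO sf r00 Ox hv.
have L0 : (0 <= Linfty_norm Omega f)%E by exact: Lnorm_ge0.
rewrite ge0_fin_numE//.
have fx : {for x, continuous f} by have [] := sf 0%N [::] isT x Ox.
have : \forall y \near x, `|f y| < `|f x| + 1.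
  by have /cvgr_norm_lt := fx; apply; rewrite ltrDl.
move=> /nbhs_ballP[e /= e0 xe].
pose r := Num.min r0 e.
have r_gt0 : 0 < r by rewrite lt_min r00.
apply: le_lt_trans (hv r x _ Ox) _; first by rewrite r_gt0 ge_min lexx.
apply: (@le_lt_trans _ _ ((expR (a / r `^ b))%:E * (`|f x| + 1)%:E)%E).
  rewrite lee_wpmul2l ?lee_fin ?expR_ge0//.
  apply: Linfty_norm_le => [|y [xy Oy]]; first by rewrite addr_ge0.
  apply/ltW/xe; split => // i j; rewrite ord1 /ball/= distrC.
  by rewrite (lt_le_trans (eball_coord _ _ _ j xy))// ge_min lexx orbT.
by rewrite -EFinM ltry.
Qed.

(** The cells inside Omega exhaust it, so at small scales they miss less than
    half of the measure w / rho.  Every set B of that measure then fills their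
    union, of measure at most w, in a proportion more than 1 / (2 rho), and some
    cell inherits this proportion.  The scale depends on B only through rho. *)
Lemma half_level_cell Omega (w rho : R) : open Omega -> mu Omega = w%:E ->
    0 < w -> 0 < rho ->
  exists m0, forall m, (m0 <= m)%N -> forall B : set (borel_rV R n.+1),
    measurable B -> B `<=` Omega -> ((w / rho)%:E <= mu B)%E ->
  exists2 k, [set x | cell m x = k] `<=` Omega &
    (((2 * rho)^-1 * (2 ^+ m)^-1 ^+ n.+1)%:E <= mu (B `&` [set x | cell m x = k]))%E.
Proof.
move=> oO Ow w0 rho0.
have mO := open_measurable_rV Omega oO.
have wr0 : 0 < w / (2 * rho) by rewrite divr_gt0// mulr_gt0.
have cv : (mu \o (inner^~ Omega)) m @[m --> \oo] --> mu Omega.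
  rewrite -[in X in _ --> X](bigcup_inner Omega oO); apply: nondecreasing_cvg_mu.
  - by move=> m; exact: measurable_inner.
  - by apply: bigcupT_measurable => m; exact: measurable_inner.
  - exact: inner_homo.
have /cv[m0 _ hm0] : nbhs (mu Omega) [set z | ((w - w / (2 * rho))%:E < z)%E].
  rewrite Ow; apply: open_nbhs_nbhs; split; last by rewrite /= lte_fin; lra.
  exact: open_ereal_gt_ereal.
exists m0 => m m0m B mB BO Bw; have := hm0 m m0m => /= Im.
have mI := measurable_inner m Omega.
apply: dense_cell => //; first by rewrite invr_ge0 mulr_ge0// ltW.
have IO : (mu (inner m Omega) <= w%:E)%E.
  by rewrite -Ow; apply: le_measure; rewrite ?inE//; exact: inner_sub.
have BIO : (mu (B `&` inner m Omega) <= w%:E)%E.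
  rewrite -Ow; apply: le_measure; rewrite ?inE//; first exact: measurableI.
  by move=> x [/BO].
have DO : (mu (Omega `\` inner m Omega) <= w%:E)%E.
  by rewrite -Ow; apply: le_measure; rewrite ?inE//; exact: measurableD.
have fin A : (mu A <= w%:E)%E -> exists2 s : R, mu A = s%:E & 0 <= s.
  move=> Aw; have fA : mu A \is a fin_num by rewrite ge0_fin_numE// (le_lt_trans Aw)// ltry.
  by exists (fine (mu A)); [rewrite fineK|rewrite fine_ge0].
have [s1 E1 s10] := fin _ IO; have [s2 E2 s20] := fin _ BIO; have [s3 E3 s30] := fin _ DO.
have Osum : mu Omega = (s3 + s1)%:E.
  rewrite EFinD -E1 -E3 (measureDI mu mO mI) (setIidr (@inner_sub _ _ m Omega))//.
have Bsum : (mu B <= (s3 + s2)%:E)%E.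
  rewrite EFinD -E2 -E3 (measureDI mu mB mI) leeD2r//.
  apply: le_measure; rewrite ?inE; [exact: measurableD|exact: measurableD|].
  by move=> x [/BO Ox xI]; split.
move: Osum Bsum; rewrite Ow => -[Osum] /(le_trans Bw); rewrite lee_fin => Bsum.
rewrite E1 lte_fin in Im; rewrite E1 E2 -EFinM lte_fin.
have wE : w / rho = 2 * (w / (2 * rho)) by field; rewrite gt_eqF.
have : (2 * rho)^-1 * s1 <= w / (2 * rho).
  by rewrite mulrC ler_pM2r ?invr_gt0 ?mulr_gt0//; lra.
rewrite wE in Bsum; lra.
Qed.

(** All parameters (scale, order N, constant) are fixed before E and f.  On the
    cell Q found by [half_level_cell], f is at most
    L^(n+1) (e + (n+1) tau) in absolute value, and the norm F of f on Omega is at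
    most A times this.  The choice of N makes the part coming from tau at most
    F / 2, leaving F <= 2 A L^(n+1) e. *)
Lemma sup_bound_at_ratio Omega (M delta a b r0 sigma rho : R) :
    open Omega -> bounded_set Omega ->
    0 < M -> 0 < delta -> 0 < a -> 0 < b -> 0 < r0 -> 1 <= sigma < 1 + 1 / b ->
  exists2 C : R, 0 < C & forall E,
    E `<=` Omega -> (0 < leb E)%E -> fine (leb Omega) / fine (leb E) = rho ->
  forall f, Cinfty_on Omega f ->
    (forall alpha : 'I_n.+1 -> nat,
      (Linfty_norm Omega (mderiv alpha f) <=
       (M * (((mlength alpha)`!)%:R `^ sigma) / delta ^+ mlength alpha)%:E
       * Linfty_norm Omega f)%E) ->
    (forall (r : R) (x : 'rV[R]_n.+1), 0 < r <= r0 -> Omega x ->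
      (Linfty_norm Omega f <=
       (expR (a / r `^ b))%:E * Linfty_norm (eball x r `&` Omega) f)%E) ->
  (Linfty_norm Omega f <= C%:E * Linfty_norm E f)%E.
Proof.
move=> oO bO M0 de0 a0 b0 r00 sb.
have mO := open_measurable_rV Omega oO.
have lO : leb Omega = mu Omega by exact: lebesgue_rVE.
have [w Ow] : exists w, mu Omega = w%:E.
  have Ooo := bounded_measure_lty Omega bO mO.
  by exists (fine (mu Omega)); rewrite fineK// ge0_fin_numE.
rewrite lO Ow /=.
(* For other values of rho and w there is no admissible E. *)
have [[rho1 w0]|deg] := pselect (1 <= rho /\ 0 < w); last first.
  exists 1 => // E EO E0 Erho; exfalso; apply: deg.
  have := le_lebesgue_rV _ _ EO; rewrite lO Ow.
  move: E0 Erho; case: (leb E) => [e| |]//=; rewrite lte_fin lee_fin => e0 <- ew.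
  by split; [rewrite ler_pdivlMr// mul1r|exact: lt_le_trans ew].
have rho0 : 0 < rho by rewrite (lt_le_trans _ rho1).
(* In dimension n + 1 propagation needs the proportion (n + 2) kappa, which is
   1 / (2 rho) here. *)
pose kappa := ((2 * rho) * n.+2%:R)^-1.
have k0 : 0 < kappa by rewrite invr_gt0 !mulr_gt0.
have k1 : kappa <= 1.
  rewrite invf_le1 ?mulr_gt0//.
  have : (1 : R) <= n.+2%:R by rewrite ler1n.
  by move=> ?; rewrite -[leLHS]mulr1 ler_pM//; lra.
pose K := 4 * expR 1 / kappa.
have K1 : 1 <= K.
  rewrite /K ler_pdivlMr// mul1r (le_trans k1)//.
  by have := expR_ge1Dx (1 : R); lra.
have [v v0 hv] := @gevrey_beats_vanishing R n.+1 K M delta a b sigma isT K1 M0 de0 a0 b0 sb.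
have [m1 hm1] := half_level_cell Omega w rho oO Ow w0 rho0.
have min0 : 0 < Num.min v (2 * r0) by rewrite lt_min v0 mulr_gt0.
have [m2 hm2] := exp2V_le _ min0.
pose m := maxn m1 m2.
pose h : R := (2 ^+ m)^-1.
have h0 : 0 < h by rewrite invr_gt0 exprn_gt0.
have /andP[h_v h_r] : (h <= v) && (h <= 2 * r0) by rewrite -le_min; apply/hm2/leq_maxr.
have [N N0 hN] := hv h (introT andP (conj h0 h_v)).
pose A := expR (a / (h / 2) `^ b).
have A0 : 0 < A by exact: expR_gt0.
pose L := K ^+ N.
have L1 : 1 <= L by rewrite exprn_ege1.
have L0 : 0 < L by rewrite (lt_le_trans _ L1).
have C0 : 0 < 2 * A * L ^+ n.+1 by apply: mulr_gt0; [exact: mulr_gt0|exact: exprn_gt0].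
exists (2 * A * L ^+ n.+1) => //.
move=> E EO E0 Erho f sf hD hB.
have cf : forall x, Omega x -> {for x, continuous f}.
  by move=> x Ox; have [] := sf 0%N [::] isT x Ox.
have [x0 Ex0] : exists x, E x.
  apply: contrapT => noE; have EE : E = set0 by rewrite -subset0 => x Ex; apply: noE; exists x.
  by move: E0; rewrite EE lebesgue_rVE// measure0 ltxx.
have Ffin := Linfty_norm_fin_num Omega f a b r0 x0 oO sf r00 (EO _ Ex0) hB.
have FL0 : (0 <= Linfty_norm Omega f)%E by exact: Lnorm_ge0.
have eL0 : (0 <= Linfty_norm E f)%E by exact: Lnorm_ge0.
have [N1 N10 hN1] := Linfty_norm_ae E f.
move: Ffin FL0 hD hB; case: (Linfty_norm Omega f) => [F| |]// _; rewrite lee_fin => F0 hD hB.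
move: eL0 hN1; case: (Linfty_norm E f) => [e| |]//; last first.
  by move=> _ _; rewrite gt0_muley ?leey// lte_fin.
rewrite lee_fin => e0 hN1.
(* Contains E up to a null set, and is Borel because f is continuous. *)
pose B : set (borel_rV R n.+1) := Omega `\` [set x | Omega x /\ e < `|f x|].
have BO : B `<=` Omega by exact: subDsetl.
have Be x : B x -> `|f x| <= e by move=> [Ox] /not_andP[]// /negP; rewrite -leNgt.
have mB : measurable B.
  by apply: measurableD => //; apply: open_measurable_rV; exact: open_superlevel.
have Bw : ((w / rho)%:E <= mu B)%E.
  have : (leb E <= leb B)%E.
    apply: (lebesgue_rV_null _ _ N1 N10) => x Ex.
    have [Nx|Nx] := pselect (N1 x); [by right|left; split; first exact: EO].
    by move=> [_]; have := hN1 x Ex Nx; rewrite lee_fin leNgt => /negP.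
  rewrite [X in (_ <= X)%E]lebesgue_rVE//; apply: le_trans.
  have := le_lebesgue_rV _ _ EO; rewrite lO Ow.
  move: E0 Erho; case: (leb E) => [e1| |]//=; rewrite lte_fin => e10 <- _.
  by rewrite lee_fin invf_div mulrC mulfVK// gt_eqF.
have [k kO kB] := hm1 m (leq_maxl _ _) B mB BO Bw.
rewrite cellE -/h in kO kB; set c := cell_corner m k in kO kB.
pose Mf := M * (N`!%:R `^ sigma) / delta ^+ N * F.
have Mf0 : 0 <= Mf by rewrite mulr_ge0// divr_ge0 ?exprn_ge0 ?mulr_ge0 ?powR_ge0// ltW.
pose tau := Mf * h ^+ N / N`!%:R.
have tau0 : 0 <= tau by rewrite divr_ge0// mulr_ge0// exprn_ge0// ltW.
have sfc : Cinfty_on (box n.+1 c h) f by move=> j s sj x cx; exact: sf j s sj x (kO x cx).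
have fM i x : box n.+1 c h x -> `|pderivs (nseq N i) f x| <= Mf.
  move=> cx; rewrite -lee_fin /Mf EFinM.
  have := hD (fun j => if j == i then N else 0%N).
  rewrite mderiv_pure mlength_pure; apply: le_trans.
  apply: Linfty_norm_pointwise => //; last exact: kO.
  by move=> y Oy; have [] := sf (size (nseq N i)) (nseq N i) (leqnn _) y Oy.
have mBc : measurable (B `&` box n.+1 c h : set (borel_rV R n.+1)).
  by apply: measurableI => //; exact: measurable_box.
have kBc : ((n.+2%:R * kappa * h ^+ n.+1)%:E <= mu (B `&` box n.+1 c h))%E.
  apply: le_trans kB; rewrite lee_fin /kappa invfM mulrCA mulfV ?mulr1//.
pose S := L ^+ n.+1 * (e + n.+1%:R * tau).
have S0 : 0 <= S.
  by apply: mulr_ge0; [exact/exprn_ge0/ltW|rewrite addr_ge0// mulr_ge0].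
have fS := smooth_box_bound f c h kappa Mf e N _ N0 h0 (introT andP (conj k0 k1))
  Mf0 e0 sfc fM mBc (@subIsetr _ _ _) kBc (fun x Bx => Be x Bx.1).
(* The ball of radius h / 2 about the centre of the cell lies in the cell. *)
pose x := c + const_mx (h / 2).
have xc y : eball x (h / 2) y -> box n.+1 c h y.
  move=> xy i; have := eball_coord x y (h / 2) i xy.
  by rewrite /x !mxE ltr_norml /in_co => /andP[? ?]; apply/andP; split; lra.
have Ox : Omega x.
  by apply/kO => i; rewrite /in_co /x !mxE; apply/andP; split; lra.
have := hB (h / 2) x _ Ox; rewrite divr_gt0//= ler_pdivrMr// mulrC => /(_ h_r) FA.
have FS : F <= A * S.
  rewrite -lee_fin EFinM; apply: (le_trans FA).
  rewrite lee_wpmul2l ?lee_fin ?expR_ge0//.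
  by apply: Linfty_norm_le => // y [/xc/fS].
have key : A * (L ^+ n.+1 * (n.+1%:R * tau)) <= F / 2.
  have -> : A * (L ^+ n.+1 * (n.+1%:R * tau)) = A * (L ^+ n.+1 * (n.+1%:R *
     (M * (N`!%:R `^ sigma) / delta ^+ N * h ^+ N / N`!%:R))) * F.
    by rewrite /tau /Mf; ring.
  rewrite [leRHS]mulrC ler_wpM2r//.
  have hA := hN; rewrite -(ler_pM2l A0) in hA.
  apply: (le_trans hA).
  by rewrite mulrCA /A -expRD subrr expR0 mulr1.
rewrite -EFinM lee_fin.
have : A * S = A * L ^+ n.+1 * e + A * (L ^+ n.+1 * (n.+1%:R * tau)) by rewrite /S; ring.
by move=> SE; rewrite SE in FS; lra.
Qed.

End main.

Theorem theorem2p3 (R : realType) (n : nat) (Omega : set 'rV[R]_n.+1)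
    (M delta a b r0 sigma : R)
    (Omega_open : open Omega) (Omega_connected : connected Omega)
    (Omega_bounded : bounded_set Omega) (Omega_C1 : C1_boundary Omega)
    (M_gt0 : 0 < M) (delta_gt0 : 0 < delta) (a_gt0 : 0 < a) (b_gt0 : 0 < b)
    (r0_gt0 : 0 < r0) (sigma_bnd : 1 <= sigma < 1 + 1 / b) :
  exists C : R -> R, (forall rho, 0 < C rho) /\
  forall E : set 'rV[R]_n.+1,
    E `<=` Omega -> lebesgue_measurable E -> (0 < lebesgue_rV E)%E ->
  forall f : 'rV[R]_n.+1 -> R, Cinfty_on Omega f ->
    (forall alpha : 'I_n.+1 -> nat,
      (Linfty_norm Omega (mderiv alpha f) <=
       (M * (((mlength alpha)`!)%:R `^ sigma) / delta ^+ mlength alpha)%:E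
       * Linfty_norm Omega f)%E) ->
    (forall (r : R) (x : 'rV[R]_n.+1), 0 < r <= r0 -> Omega x ->
      (Linfty_norm Omega f <=
       (expR (a / r `^ b))%:E * Linfty_norm (eball x r `&` Omega) f)%E) ->
  (Linfty_norm Omega f <=
   (C (fine (lebesgue_rV Omega) / fine (lebesgue_rV E)))%:E
   * Linfty_norm E f)%E.
Proof.
have bound rho := sup_bound_at_ratio Omega M delta a b r0 sigma rho Omega_open
  Omega_bounded M_gt0 delta_gt0 a_gt0 b_gt0 r0_gt0 sigma_bnd.
exists (fun rho => projT1 (cid2 (bound rho))); split.
  by move=> rho; case: cid2.
move=> E EO _ E0 f sf hD hB; case: cid2 => /= C C0; exact.
Qed.
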